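(* Let $Y$ be a Hausdorff space. The following are equivalent: (i) $Y$ is compact; (ii) the map $Y\to\{\bullet\}$ belongs to $$\Bigl\{\ \{a\leftrightarrow b\}\to\{\bullet\},\ \ \{o\to c\}\to\{\bullet\},\ \ \{c\}\to\{o\to c\},\ \ \{a\leftarrow u\to b\}\to\{\bullet\}\ \Bigr\}^{lr};$$ (iii) the map $Y\to\{\bullet\}$ belongs to $$\Bigl\{\ \{a\leftarrow u\to b\leftrightarrow x\}\to\{o\to c\}\ \Bigr\}^{lr},$$ where the map in (iii) sends all four points $a,u,b,x$ to $c$.
   Context: All maps are continuous; classes are computed in the category of all topological spaces. $\{\bullet\}$ is the one-point space. $\{a\leftrightarrow b\}$ is the indiscrete two-point space. $\{o\to c\}$ is the Sierpinski space with open point $o$ and closed point $c$; $\{c\}\to\{o\to c\}$ is the inclusion of the closed point. $\{a\leftarrow u\to b\}$ is the three-point space with one open point $u$ and two closed points $a,b$ (open sets $\emptyset,\{u\},\{a,u\},\{u,b\},\{a,u,b\}$). $\{a\leftarrow u\to b\leftrightarrow x\}$ is the four-point space with open sets $\emptyset,\{u\},\{a,u\},\{u,b,x\},\{a,u,b,x\}$ (so $b$ and $x$ are topologically indistinguishable). For maps $f:A\to B$, $g:X\to Y$, $f\pitchfork g$ means: for all $t:A\to X$, $s:B\to Y$ with $g\circ t=s\circ f$ there is $h:B\to X$ with $h\circ f=t$ and $g\circ h=s$. For a class $P$ of maps, $P^l=\{f:\ f\pitchfork g \text{ for all } g\in P\}$, $P^r=\{g:\ f\pitchfork g\text{ for all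 } f\in P\}$, $P^{lr}=(P^l)^r$. *)

(* Defs.v *)
From Stdlib Require List.
From HB Require Import structures.
From mathcomp Require Import all_boot all_classical all_analysis.

Set Implicit Arguments.
Unset Strict Implicit.
Unset Printing Implicit Defensive.

Local Open Scope classical_set_scope.

(* The topologicalType structure does not require a point, so the empty space
   is one of the objects over which lifting properties are tested. *)
Record cmap := CMap {
  src : topologicalType;
  tgt : topologicalType;
  cmap_fun :> continuousType src tgt
}.

Arguments CMap {src tgt} cmap_fun.

Definition lifts (f g : cmap) : Prop :=
  forall (t : continuousType (src f) (src g))
         (s : continuousType (tgt f) (tgt g)),
    g \o t =1 s \o f ->
    exists h : continuousType (tgt f) (src g), h \o f =1 t /\ g \o h =1 s.

(* A plain predicate: the universe of [set] is below that of [cmap]. *)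
Definition map_class := cmap -> Prop.

Definition class_of_seq (s : seq cmap) : map_class := fun g => List.In g s.

Definition left_orth (P : map_class) : map_class :=
  fun f => forall g, P g -> lifts f g.

Definition right_orth (P : map_class) : map_class :=
  fun g => forall f, P f -> lifts f g.

Definition lr_orth (P : map_class) : map_class := right_orth (left_orth P).

Variant one_point := bullet.
Variant indiscrete2 := ind_a | ind_b.
Variant sierpinski := sier_o | sier_c.
Variant fork := fork_a | fork_u | fork_b.
Variant forkx := forkx_a | forkx_u | forkx_b | forkx_x.

Definition one_point_open : set_system one_point :=
  [set set0; [set: one_point]].

Definition indiscrete2_open : set_system indiscrete2 :=
  [set set0; [set: indiscrete2]].

Definition sierpinski_open : set_system sierpinski :=
  [set set0; [set sier_o]; [set: sierpinski]].

Definition fork_open : set_system fork :=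
  [set set0; [set fork_u]; [set fork_a; fork_u]; [set fork_u; fork_b];
       [set: fork]].

Definition forkx_open : set_system forkx :=
  [set set0; [set forkx_u]; [set forkx_a; forkx_u];
       [set forkx_u; forkx_b; forkx_x]; [set: forkx]].

Lemma one_point_openE (A : set one_point) : one_point_open A <-> True.
Proof.
split=> // _; have [Aa|nA] := pselect (A bullet); [right|left];
  by apply/seteqP; split=> -[].
Qed.

Lemma indiscrete2_openE (A : set indiscrete2) :
  indiscrete2_open A <-> (A ind_a <-> A ind_b).
Proof.
split=> [[->|->] //|[ab ba]].
have [Aa|nAa] := pselect (A ind_a).
  by right; apply/seteqP; split=> -[] //= _; exact: ab.
by left; apply/seteqP; split=> -[] //= /ba.
Qed.

Lemma sierpinski_openE (A : set sierpinski) :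
  sierpinski_open A <-> (A sier_c -> A sier_o).
Proof.
split=> [[[->|->]|->] //|co].
have [Ac|nAc] := pselect (A sier_c).
  by right; apply/seteqP; split=> -[] //= _; exact: co.
have [Ao|nAo] := pselect (A sier_o).
  by left; right; apply/seteqP; split=> -[] //=.
by left; left; apply/seteqP; split=> -[].
Qed.

Lemma fork_openE (A : set fork) :
  fork_open A <-> (A fork_a -> A fork_u) /\ (A fork_b -> A fork_u).
Proof.
split=> [[[[[->|->]|->]|->]|->] /=|[au bu]]; try by intuition.
have [Au|nAu] := pselect (A fork_u); last first.
  by do 4 left; apply/seteqP; split=> -[] //= ?; tauto.
have [Aa|nAa] := pselect (A fork_a); have [Ab|nAb] := pselect (A fork_b).
- by right; apply/seteqP; split=> -[].
- by do 2 left; right; apply/seteqP; split=> -[] //=; intuition.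
- by left; right; apply/seteqP; split=> -[] //=; intuition.
- by do 3 left; right; apply/seteqP; split=> -[] //=; intuition.
Qed.

Lemma forkx_openE (A : set forkx) :
  forkx_open A <->
  [/\ A forkx_a -> A forkx_u, A forkx_b -> A forkx_u & A forkx_b <-> A forkx_x].
Proof.
split=> [[[[[->|->]|->]|->]|->] /=|[au bu bx]]; try by split; intuition discriminate.
have [Au|nAu] := pselect (A forkx_u); last first.
  by do 4 left; apply/seteqP; split=> -[] //= ?; tauto.
have [Aa|nAa] := pselect (A forkx_a); have [Ab|nAb] := pselect (A forkx_b).
- by right; apply/seteqP; split=> -[] //= ?; tauto.
- by do 2 left; right; apply/seteqP; split=> -[] //=; intuition discriminate.
- by left; right; apply/seteqP; split=> -[] //=; intuition discriminate.
- by do 3 left; right; apply/seteqP; split=> -[] //=; intuition discriminate.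
Qed.

HB.instance Definition _ := gen_eqMixin one_point.
HB.instance Definition _ := gen_choiceMixin one_point.
HB.instance Definition _ := gen_eqMixin indiscrete2.
HB.instance Definition _ := gen_choiceMixin indiscrete2.
HB.instance Definition _ := gen_eqMixin sierpinski.
HB.instance Definition _ := gen_choiceMixin sierpinski.
HB.instance Definition _ := gen_eqMixin fork.
HB.instance Definition _ := gen_choiceMixin fork.
HB.instance Definition _ := gen_eqMixin forkx.
HB.instance Definition _ := gen_choiceMixin forkx.

Fact one_point_openT : one_point_open setT. Proof. by apply/one_point_openE. Qed.
Fact one_point_openI : setI_closed one_point_open.
Proof. by move=> A B _ _; apply/one_point_openE. Qed.
Fact one_point_open_bigU (I : Type) (f : I -> set one_point) :
  (forall i, one_point_open (f i)) -> one_point_open (\bigcup_i f i).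
Proof. by move=> _; apply/one_point_openE. Qed.

HB.instance Definition _ :=
  isOpenTopological.Build one_point
    one_point_openT one_point_openI one_point_open_bigU.

Fact indiscrete2_openT : indiscrete2_open setT.
Proof. by apply/indiscrete2_openE. Qed.
Fact indiscrete2_openI : setI_closed indiscrete2_open.
Proof.
by move=> A B /indiscrete2_openE ? /indiscrete2_openE ?;
  apply/indiscrete2_openE; rewrite /setI /=; tauto.
Qed.
Fact indiscrete2_open_bigU (I : Type) (f : I -> set indiscrete2) :
  (forall i, indiscrete2_open (f i)) -> indiscrete2_open (\bigcup_i f i).
Proof.
move=> fo; apply/indiscrete2_openE.
by split=> -[i _ fi]; exists i => //; have /indiscrete2_openE := fo i; tauto.
Qed.

HB.instance Definition _ := isOpenTopological.Build indiscrete2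
  indiscrete2_openT indiscrete2_openI indiscrete2_open_bigU.

Fact sierpinski_openT : sierpinski_open setT.
Proof. by apply/sierpinski_openE. Qed.
Fact sierpinski_openI : setI_closed sierpinski_open.
Proof.
by move=> A B /sierpinski_openE ? /sierpinski_openE ?;
  apply/sierpinski_openE; rewrite /setI /=; tauto.
Qed.
Fact sierpinski_open_bigU (I : Type) (f : I -> set sierpinski) :
  (forall i, sierpinski_open (f i)) -> sierpinski_open (\bigcup_i f i).
Proof.
move=> fo; apply/sierpinski_openE => -[i _ fi].
by exists i => //; move/sierpinski_openE: (fo i); apply.
Qed.

HB.instance Definition _ := isOpenTopological.Build sierpinski
  sierpinski_openT sierpinski_openI sierpinski_open_bigU.

Fact fork_openT : fork_open setT.
Proof. by apply/fork_openE. Qed.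
Fact fork_openI : setI_closed fork_open.
Proof.
by move=> A B /fork_openE ? /fork_openE ?;
  apply/fork_openE; rewrite /setI /=; tauto.
Qed.
Fact fork_open_bigU (I : Type) (f : I -> set fork) :
  (forall i, fork_open (f i)) -> fork_open (\bigcup_i f i).
Proof.
move=> fo; apply/fork_openE.
by split=> -[i _ fi]; exists i => //; have /fork_openE := fo i; tauto.
Qed.

HB.instance Definition _ := isOpenTopological.Build fork
  fork_openT fork_openI fork_open_bigU.

Fact forkx_openT : forkx_open setT.
Proof. by apply/forkx_openE. Qed.
Fact forkx_openI : setI_closed forkx_open.
Proof.
by move=> A B /forkx_openE[? ? ?] /forkx_openE[? ? ?];
  apply/forkx_openE; rewrite /setI /=; split; tauto.
Qed.
Fact forkx_open_bigU (I : Type) (f : I -> set forkx) :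
  (forall i, forkx_open (f i)) -> forkx_open (\bigcup_i f i).
Proof.
move=> fo; apply/forkx_openE.
by split; [| |split]=> -[i _ fi]; exists i => //;
  have /forkx_openE[? ? ?] := fo i; tauto.
Qed.

HB.instance Definition _ := isOpenTopological.Build forkx
  forkx_openT forkx_openI forkx_open_bigU.

(* Every map below is constant, and constant maps are canonically
   continuous. *)
Definition to_point (X : topologicalType) : cmap :=
  CMap (cst bullet : continuousType X one_point).

(* The subspace {c} is identified with the one-point space. *)
Definition closed_point_incl : cmap :=
  CMap (cst sier_c : continuousType one_point sierpinski).

Definition forkx_to_closed_point : cmap :=
  CMap (cst sier_c : continuousType forkx sierpinski).

(* Main.v *)
(* A map is left orthogonal to either class when it is a dense embedding along
   which disjoint closed sets have disjoint closures. The four maps of (ii) and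
   the single map of (iii) define the same left class: the fibre of the latter
   retracts onto the three spaces, and is glued back from two of them. Taimanov's
   theorem extends maps to compact Hausdorff spaces along such embeddings.
   Conversely, adjoining to [Y] a limit of an ultrafilter is such an embedding,
   and a retraction onto [Y] makes the ultrafilter converge. *)
From HB Require Import structures.
Require Import Defs.
From mathcomp Require Import all_boot all_classical all_analysis.

Local Open Scope classical_set_scope.

(** * Retracts of the four-point fibre, and equality of the two left classes *)

Definition forkx_indiscrete (z : forkx) : indiscrete2 :=
  if z is forkx_x then ind_b else ind_a.

Definition forkx_sierpinski (z : forkx) : sierpinski :=
  match z with forkx_a | forkx_u => sier_o | _ => sier_c end.

Definition forkx_fork (z : forkx) : fork :=
  match z with forkx_a => fork_a | forkx_u => fork_u | _ => fork_b end.

Definition indiscrete_forkx (z : indiscrete2) : forkx :=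
  if z is ind_b then forkx_x else forkx_b.

Definition sierpinski_forkx (z : sierpinski) : forkx :=
  if z is sier_o then forkx_u else forkx_b.

Definition fork_forkx (z : fork) : forkx :=
  match z with fork_a => forkx_a | fork_u => forkx_u | _ => forkx_b end.

Lemma forkx_indiscrete_continuous : continuous forkx_indiscrete.
Proof.
by apply/continuousP => O /indiscrete2_openE OE; apply/forkx_openE;
  rewrite /preimage /=; split; tauto.
Qed.

Lemma forkx_sierpinski_continuous : continuous forkx_sierpinski.
Proof.
by apply/continuousP => O /sierpinski_openE OE; apply/forkx_openE;
  rewrite /preimage /=; split; tauto.
Qed.

Lemma forkx_fork_continuous : continuous forkx_fork.
Proof.
by apply/continuousP => O /fork_openE OE; apply/forkx_openE;
  rewrite /preimage /=; split; tauto.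
Qed.

Lemma indiscrete_forkx_continuous : continuous indiscrete_forkx.
Proof.
by apply/continuousP => O /forkx_openE[? ? ?]; apply/indiscrete2_openE;
  rewrite /preimage /=; tauto.
Qed.

Lemma sierpinski_forkx_continuous : continuous sierpinski_forkx.
Proof.
by apply/continuousP => O /forkx_openE[? ? ?]; apply/sierpinski_openE;
  rewrite /preimage /=; tauto.
Qed.

Lemma fork_forkx_continuous : continuous fork_forkx.
Proof.
by apply/continuousP => O /forkx_openE[? ? ?]; apply/fork_openE;
  rewrite /preimage /=; tauto.
Qed.

(* A retract of the fibre [forkx] over the closed point inherits its lifting
   property: lift through the section, then retract. *)
Lemma lifts_retract (Z : topologicalType) (f : cmap)
    (i : continuousType Z forkx) (r : continuousType forkx Z) :
  cancel i r -> lifts f forkx_to_closed_point -> lifts f (to_point Z).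
Proof.
move=> irK flift t s _.
have [//|h [ht _]] := flift (i \o t : continuousType _ _) (cst sier_c).
exists (r \o h : continuousType _ _); split=> x /=; last by case: (s x).
by have /= -> := ht x; rewrite irK.
Qed.

Notation quad := [:: to_point indiscrete2; to_point sierpinski;
                     closed_point_incl; to_point fork].

Lemma left_orth_forkx_quad (f : cmap) :
  left_orth (class_of_seq [:: forkx_to_closed_point]) f ->
  left_orth (class_of_seq quad) f.
Proof.
move=> /(_ forkx_to_closed_point (or_introl erefl)) flift g.
move=> [<-|[<-|[<-|[<-|//]]]].
- by apply: (@lifts_retract _ _ (mkcts indiscrete_forkx_continuous)
    (mkcts forkx_indiscrete_continuous)) flift; case.
- by apply: (@lifts_retract _ _ (mkcts sierpinski_forkx_continuous)
    (mkcts forkx_sierpinski_continuous)) flift; case.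
(* The choice of [forkx_u] is immaterial: a lift of any upper map forces [s] to be [sier_c]
   everywhere. *)
- move=> t s sfc; have [//|h [_ hs]] := flift (cst forkx_u) s.
  by exists (cst bullet); split=> x; [rewrite /=; case: (t x)|exact: hs].
- by apply: (@lifts_retract _ _ (mkcts fork_forkx_continuous)
    (mkcts forkx_fork_continuous)) flift; case.
Qed.

Definition glue_forkx (z : fork) (w : indiscrete2) : forkx :=
  match z, w with
  | fork_b, ind_b => forkx_x
  | _, _ => fork_forkx z
  end.

(* [forkx] is obtained from [fork] by splitting the point [b] in two by a
   map to [indiscrete2], and no open set sees that map. *)
Lemma left_orth_quad_forkx (f : cmap) :
  left_orth (class_of_seq quad) f ->
  left_orth (class_of_seq [:: forkx_to_closed_point]) f.
Proof.
move=> fP g [<-|//] t s sfc.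
(* The square only gives [s = sier_c] on the image of [f]; this lift extends it to the whole
   target. *)
have [] := fP closed_point_incl _ (cst bullet) s.
- by do 2 right; left.
- exact: sfc.
move=> h0 [_ hs].
have [||h1 [h1t _]] := fP (to_point fork) _
  (mkcts forkx_fork_continuous \o t : continuousType _ _) (cst bullet).
- by do 3 right; left.
- by [].
have [||h2 [h2t _]] := fP (to_point indiscrete2) _
  (mkcts forkx_indiscrete_continuous \o t : continuousType _ _) (cst bullet).
- by left.
- by [].
have hc : continuous (fun y => glue_forkx (h1 y) (h2 y)).
  apply/continuousP => O Oo.
  suff -> : (fun y => glue_forkx (h1 y) (h2 y)) @^-1` O =
            h1 @^-1` (fork_forkx @^-1` O).
    have /continuousP := @cts_fun _ _ h1; apply.
    by have /continuousP := fork_forkx_continuous; apply.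
  have [_ _ bx] := (forkx_openE O).1 Oo.
  by apply/seteqP; split=> y; rewrite /preimage /=;
    case: (h1 y); case: (h2 y) => //=; tauto.
exists (mkcts hc); split=> x; last exact: hs.
have /= := h1t x; have /= := h2t x; rewrite /mkcts /= => -> ->.
by case: (t x).
Qed.

Lemma lr_orth_quad_forkx (g : cmap) :
  lr_orth (class_of_seq quad) g <->
  lr_orth (class_of_seq [:: forkx_to_closed_point]) g.
Proof.
by split=> gP f fP; apply: gP;
  [exact: left_orth_forkx_quad|exact: left_orth_quad_forkx].
Qed.

(** * Taimanov's extension theorem *)

(** If [V] missed the image of [f], its indicator into [sierpinski] would be [sier_c] on that image,
    hence everywhere by lifting against [closed_point_incl]. *)
Lemma left_orth_quad_dense (f : cmap) (V : set (tgt f)) :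
  left_orth (class_of_seq quad) f -> open V -> V !=set0 ->
  exists a, V (f a).
Proof.
move=> fP Vo [b Vb]; apply: contrapT => nV.
pose s y := if pselect (V y) then sier_o else sier_c.
have sc : continuous s.
  apply/continuousP => O /sierpinski_openE OE.
  have [Oc|nOc] := pselect (O sier_c).
    suff -> : s @^-1` O = setT by exact: openT.
    by apply/seteqP; split=> y //= _; rewrite /s; case: pselect => /= ?; auto.
  have [Oo|nOo] := pselect (O sier_o).
    suff -> : s @^-1` O = V by [].
    by apply/seteqP; split=> y; rewrite /preimage /s /=; case: pselect.
  suff -> : s @^-1` O = set0 by exact: open0.
  by apply/seteqP; split=> y //; rewrite /preimage /s /=; case: pselect.
have [|x|h [_ /(_ b)]] := fP closed_point_incl _ (cst bullet) (mkcts sc).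
- by do 2 right; left.
- by rewrite /= /mkcts /s; case: pselect => // Vx; case: nV; exists x.
- by rewrite /= /mkcts /s; case: pselect.
Qed.

(** [F] and [G] are the fibres over the two closed points of a map to [fork]; the same fibres of its
    extension along [f] separate them. *)
Lemma left_orth_quad_separate (f : cmap) (F G : set (src f)) :
  left_orth (class_of_seq quad) f ->
  closed F -> closed G -> (forall x, F x -> ~ G x) ->
  exists F' G' : set (tgt f),
    [/\ closed F', closed G', forall y, F' y -> ~ G' y,
        F `<=` f @^-1` F' & G `<=` f @^-1` G'].
Proof.
move=> fP Fc Gc FG.
pose t x := if pselect (F x) then fork_a
            else if pselect (G x) then fork_b else fork_u.
have tc : continuous t.
  apply/continuousP => O /fork_openE[au bu].
  (* An open [O] without [fork_u] is empty; otherwise omitting [fork_a] or [fork_b] removes [F] or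
     [G]. *)
  have -> : t @^-1` O =
      (if pselect (O fork_u) then setT else set0) `&`
      (if pselect (O fork_a) then setT else ~` F) `&`
      (if pselect (O fork_b) then setT else ~` G).
    apply/seteqP; split=> x; rewrite /preimage /setI /t /=;
      do ![case: pselect => //= ?]; try tauto; by have := FG x; tauto.
  by apply: openI; [apply: openI|]; case: pselect => ?;
    rewrite ?openC //; [exact: openT|exact: open0|exact: openT|exact: openT].
have [||h [ht _]] := fP (to_point fork) _ (mkcts tc) (cst bullet).
- by do 3 right; left.
- by [].
have closed_h z : open (~` [set z]) -> closed (h @^-1` [set z]).
  by rewrite openC => zc; apply: closed_comp zc => x _; exact: cts_fun.
exists (h @^-1` [set fork_a]), (h @^-1` [set fork_b]); split.
- by apply: closed_h; apply/fork_openE; split=> //= _.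
- by apply: closed_h; apply/fork_openE; split=> //= _.
- by move=> y /= ->.
- by move=> x Fx; have /= -> := ht x; rewrite /mkcts /t; case: pselect.
- move=> x Gx; have /= -> := ht x; rewrite /mkcts /t.
  by case: pselect => [/FG //|?]; case: pselect.
Qed.

Section taimanov.
Variables (f : cmap) (Y : topologicalType) (t : continuousType (src f) Y).
Hypothesis fP : left_orth (class_of_seq quad) f.
Hypothesis hY : hausdorff_space Y.
Hypothesis cY : compact [set: Y].

(* [y] is a limit value of [t] at [b]; the extension of [t] along [f] is the
   function with this graph. *)
Let limval (b : tgt f) (y : Y) : Prop :=
  forall V U, nbhs b V -> nbhs y U -> exists2 a, V (f a) & U (t a).

(** By density, the neighbourhoods of [b] pulled back along [f] and pushed forward by [t] generate a
    proper filter; compactness gives it a cluster point. *)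
Lemma limval_exists b : exists y, limval b y.
Proof.
pose Phi : set_system Y :=
  [set S | exists2 V, nbhs b V & f @^-1` V `<=` t @^-1` S].
have PhiF : ProperFilter Phi.
  split.
    move=> [V]; rewrite nbhsE => -[W [Wo Wb] WV] VS.
    have [a Wa] := @left_orth_quad_dense f W fP Wo (ex_intro _ b Wb).
    exact: (VS a (WV _ Wa)).
  split.
  - by exists setT => //; exact: filterT.
  - move=> P Q [V Vb VP] [W Wb WQ]; exists (V `&` W); first exact: filterI.
    by move=> a [Va Wa]; split; [exact: VP|exact: WQ].
  - by move=> P Q PQ [V Vb VP]; exists V => // a Va; exact/PQ/VP.
have [|y [_ yc]] := cY Phi PhiF; first by exists setT => //; exact: filterT.
exists y => V U Vb Uy.
have [|_ [[a Va <-] Ua]] := yc (t @` (f @^-1` V)) U _ Uy; last by exists a.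
by exists V => // a Va; exists a.
Qed.

(** The core of the argument: it yields both uniqueness of limit values and continuity of the
    extension. *)
Lemma limval_near b y U : limval b y -> nbhs y U ->
  exists2 V, nbhs b V & forall b' y', V b' -> limval b' y' -> U y'.
Proof.
move=> by_ Uy.
have reg : {for y, regular_space Y}.
  exact: compact_regular hY cY filterT.
(* Of the nested neighbourhoods, [closure N] inside [M°] makes the two closed preimages below
   disjoint, and [closure M] inside [U] makes its complement a neighbourhood of any [y'] outside
   [U]. *)
have [M My MU] := reg U Uy.
have [N Ny NM] := reg _ (nbhs_interior My).
have closed_t A : closed A -> closed (t @^-1` A).
  by move=> Ac; apply: closed_comp Ac => x _; exact: cts_fun.
have [|||F [G [Fc Gc FG NF MG]]] := @left_orth_quad_separate f
  (t @^-1` closure N) (t @^-1` (~` M°)) fP.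
- by apply: closed_t; exact: closed_closure.
- by apply: closed_t; apply: open_closedC; exact: open_interior.
- by move=> x /NM Mtx; apply.
(* [b] is adherent to the [f]-image of the points that [t] sends into [N]. *)
have Fb : F b.
  apply: Fc => V Vb; have [a Va Na] := by_ V N Vb Ny.
  by exists (f a); split=> //; apply: NF; exact: subset_closure.
exists (~` G).
  by apply: open_nbhs_nbhs; split; [exact: closed_openC|exact: FG].
move=> b' y' Gb' by'; apply: contrapT => nUy'.
have [||a Ga Ma] := by' (~` G) (~` closure M).
- by apply: open_nbhs_nbhs; split=> //; exact: closed_openC.
- apply: open_nbhs_nbhs; split; first exact/closed_openC/closed_closure.
  by move=> /MU.
- apply: Ga; apply: MG => Mta; apply: Ma.
  by apply: subset_closure; exact: interior_subset.
Qed.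

(** The neighbourhood found by [limval_near] contains [b] itself, so every neighbourhood of [y]
    contains [y']. *)
Lemma limval_unique b y y' : limval b y -> limval b y' -> y = y'.
Proof.
move=> by_ by'; apply: hY => A B Ay By'; exists y'; split.
  by have [V Vb VA] := limval_near _ _ _ by_ Ay; exact: VA (nbhs_singleton Vb) by'.
exact: nbhs_singleton.
Qed.

Lemma left_orth_quad_extend :
  exists h : continuousType (tgt f) Y, h \o f =1 t.
Proof.
have [h hP] := choice limval_exists.
have hc : continuous h.
  move=> b U Uhb; have [V Vb VU] := limval_near _ _ _ (hP b) Uhb.
  by apply: filterS Vb => b' Vb'; exact: VU Vb' (hP b').
(* By continuity, [a] itself witnesses that [t a] is a limit value at [f a]. *)
exists (mkcts hc) => a; apply: limval_unique (hP (f a)) _ => V U Vfa Uta.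
have fV : nbhs a (f @^-1` V) by exact: (@cts_fun _ _ f a V).
have tU : nbhs a (t @^-1` U) by exact: (@cts_fun _ _ t a U).
by have [Va Ua] := nbhs_singleton (filterI fV tU); exists a.
Qed.

End taimanov.

Lemma compact_lr_orth_quad (Y : topologicalType) :
  hausdorff_space Y -> compact [set: Y] ->
  lr_orth (class_of_seq quad) (to_point Y).
Proof.
move=> hY cY f fP t s _.
have [h ht] := @left_orth_quad_extend f Y t fP hY cY.
by exists h; split=> // y; rewrite /=; case: (s y).
Qed.

(** * Adjoining a limit of an ultrafilter *)

(* [Y] with an extra point [None] whose neighbourhoods trace the filter [F]. *)
Definition adjoin_limit (Y : topologicalType) (F : filter_on Y) : Type :=
  option Y.

Section adjoin_limit.
Variables (Y : topologicalType) (F : filter_on Y).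

HB.instance Definition _ := Choice.on (adjoin_limit Y F).

Definition adjoin_limit_open : set_system (adjoin_limit Y F) :=
  [set O | open (Some @^-1` O) /\ (O None -> filter.filter F (Some @^-1` O))].

Fact adjoin_limit_openT : adjoin_limit_open setT.
Proof. by split=> [|_]; [exact: openT|exact: filterT]. Qed.

Fact adjoin_limit_openI : setI_closed adjoin_limit_open.
Proof.
move=> A B [Ao AF] [Bo BF]; split; first exact: openI.
by move=> [/AF FA /BF FB]; exact: filterI.
Qed.

Fact adjoin_limit_open_bigU (I : Type) (f : I -> set (adjoin_limit Y F)) :
  (forall i, adjoin_limit_open (f i)) -> adjoin_limit_open (\bigcup_i f i).
Proof.
move=> fo; split.
  by rewrite preimage_bigcup; apply: bigcup_open => i _; exact: (fo i).1.
move=> [i _ /(fo i).2]; apply: filterS => y fiy; by exists i.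
Qed.

HB.instance Definition _ := isOpenTopological.Build (adjoin_limit Y F)
  adjoin_limit_openT adjoin_limit_openI adjoin_limit_open_bigU.

Definition adjoin_limit_incl (y : Y) : adjoin_limit Y F := Some y.

Lemma adjoin_limit_incl_continuous : continuous adjoin_limit_incl.
Proof. by apply/continuousP => O []. Qed.

Lemma adjoin_limit_left_orth : UltraFilter (filter.filter F) ->
  left_orth (class_of_seq [:: forkx_to_closed_point])
    (CMap (mkcts adjoin_limit_incl_continuous)).
Proof.
move=> FU g [<-|//] t s sfc.
(* The ultrafilter selects one of the pieces [a], [{b,x}], [u], so [t] converges along it; the limit
   [z] is the value of the lift at [None]. *)
have [z Fz] : exists z : forkx, forall O : set forkx,
    open O -> O z -> filter.filter F (t @^-1` O).
  have [Fa|Fna] := in_ultra_setVsetC (t @^-1` [set forkx_a]) FU.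
    by exists forkx_a => O _ Oa; apply: filterS Fa => y /= ->.
  have [Fb|Fnb] :=
      in_ultra_setVsetC (t @^-1` [set z | z = forkx_b \/ z = forkx_x]) FU.
    exists forkx_b => O /forkx_openE[_ _ bx] Ob.
    by apply: filterS Fb => y /= [] -> //; apply/bx.
  exists forkx_u => O _ Ou; apply: filterS (filterI Fna Fnb) => y /=.
  by rewrite /preimage /setC /=; case: (t y) => //; tauto.
pose h (w : adjoin_limit Y F) := if w is Some y then t y else z.
have hc : continuous h.
  apply/continuousP => O Oo; split; last exact: (Fz O Oo).
  by have /continuousP := @cts_fun _ _ t; apply.
exists (mkcts hc); split=> // -[y|]; first exact: sfc.
(* Were [s None] equal to [sier_o], the trace of this open set on [Y] would lie in [F]; but it is
   empty, as [s] is [sier_c] on [Y]. *)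
have [_ sF] : adjoin_limit_open (s @^-1` [set sier_o]).
  have /continuousP := @cts_fun _ _ s; apply.
  exact/sierpinski_openE.
case sN : (s None) => //; have := sF sN.
rewrite (_ : Some @^-1` _ = set0) => [/filter_not_empty //|].
apply/seteqP; split=> // y; rewrite /preimage /=.
by have /= := sfc y; rewrite /mkcts /adjoin_limit_incl => <-.
Qed.

Lemma adjoin_limit_retract_cvg (r : adjoin_limit Y F -> Y) :
  continuous r -> (forall y, r (Some y) = y) -> filter.filter F --> r None.
Proof.
move=> rc rK U; rewrite nbhsE => -[W [Wo Wr] WU].
have /continuousP/(_ W Wo) [_ /(_ Wr)] := rc.
by apply: filterS => y; rewrite /preimage /= rK; exact: WU.
Qed.

End adjoin_limit.

Lemma lr_orth_forkx_compact (Y : topologicalType) :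
  lr_orth (class_of_seq [:: forkx_to_closed_point]) (to_point Y) ->
  compact [set: Y].
Proof.
move=> YP; rewrite compact_ultra => F FU _.
pose F' := FilterType F (@ultra_proper _ _ FU).
(* A lift of the identity of [Y] is a retraction, which sends [None] to a limit of [F]. *)
have [//|r [rK _]] :=
  YP _ (@adjoin_limit_left_orth Y F' FU) idfun (cst bullet).
exists (r None); split=> //.
by apply: (@adjoin_limit_retract_cvg Y F' r) => [|y];
  [exact: cts_fun|exact: rK].
Qed.

Theorem corollary4p2 (Y : topologicalType) (hY : hausdorff_space Y) :
  (compact [set: Y] <->
     lr_orth (class_of_seq [:: to_point indiscrete2; to_point sierpinski;
                               closed_point_incl; to_point fork])
       (to_point Y)) /\
  (compact [set: Y] <->
     lr_orth (class_of_seq [:: forkx_to_closed_point]) (to_point Y)).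
Proof.
have cP := @compact_lr_orth_quad Y hY.
have Pc := @lr_orth_forkx_compact Y.
have [qx xq] := lr_orth_quad_forkx (to_point Y).
split; split.
- exact: cP.
- by move=> /qx; exact: Pc.
- by move=> /cP; exact: qx.
- exact: Pc.
Qed.
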